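(* Let $\ell\ge1$ and let $C_{HN}\colon\mathbb{V}_{CG,\ell}\to\mathbb{V}_{CG,\ell}$ be a linear operator satisfying $C_{HN}\,\mathcal{P}_{CG,\ell-1}^{\ell}v=\mathcal{P}_{CG,\ell-1}^{\ell}v$ for all $v\in\mathbb{V}_{CG,\ell-1}$. Then the operator identity $$\mathcal{G}_{\ell-1}^T\,\mathcal{R}_{\mathrm{cell},\ell}^{\ell-1}=\mathcal{R}_{CG,\ell}^{\ell-1}\,C_{HN}^T\,\mathcal{G}_\ell^T$$ holds on all of $\mathbb{V}_{\mathrm{cell},\ell}^*$. In particular, for the unmasked cell-wise residual $\tilde r_\ell=\tilde b_\ell-A_{\mathrm{cell},\ell}u_\ell$ (with $\tilde b_\ell\in\mathbb{V}_{\mathrm{cell},\ell}^*$ and $u_\ell\in\mathbb{V}_{\mathrm{cell},\ell}$ the iterate after local smoothing), the global assembly of its cell-wise restriction equals the result of assembling the fine-grid residual, applying $C_{HN}^T$, and applying the classical global restriction $\mathcal{R}_{CG,\ell}^{\ell-1}$.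
   Context: $\Omega\subset\mathbb{R}^d$ ($d\in\{2,3\}$) carries a conforming coarse mesh $\mathcal{T}_0$ of quadrilaterals/hexahedra. Cells may be recursively and locally refined, each refinement splitting a parent cell $K$ isotropically into $2^d$ children $K_c$ (bits $b_1,\dots,b_d\in\{0,1\}$ of the child index $c$ give the half of the reference interval in each direction; a child inherits the reference coordinates of its parent, $F_{K_c}(\xi)=F_K((\xi+b)/2)$ on $[0,1]^d$). $\mathcal{T}_\ell$ is the set of all cells of level $\ell$ (further refined or not), a conforming mesh of $\Omega_\ell=\bigcup_{K\in\mathcal{T}_\ell}K$. Continuous tensor-product elements $\mathbb{Q}_p$ with Gauss–Lobatto nodal basis are used. $\mathbb{V}_{\mathrm{cell},\ell}$ is the broken space of all cell-local coefficient vectors on $\mathcal{T}_\ell$ (one independent set of $(p+1)^d$ nodal values per cell); $\mathbb{V}_{CG,\ell}$ is the space of continuous $\mathbb{Q}_p$ functions on $\mathcal{T}_\ell$ vanishing on $\partial\Omega$, identified with its coefficient vectors (homogeneous Dirichlet DoFs on $\partial\Omega$ are eliminated; their local copies are zero in gathered vectors). The gather $\mathcal{G}_\ell\colon\mathbb{V}_{CG,\ell}\to\mathbb{V}_{\mathrm{cell},\ell}$ replicates each global coefficient into all its cell-local copies; its transpose $\mathcal{G}_\ell^T\colon\mathbb{V}_{\mathrm{cell},\ell}^*\to\mathbb{V}_{CG,\ell}^*$ is additive assembly. All duality pairings are Euclidean pairings of coefficient vectors and transposes are taken with respect to them. $A_{\mathrm{cell},\ell}\colon\mathbb{V}_{\mathrm{cell},\ell}\to\mathbb{V}_{\mathrm{cell},\ell}^*$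 is the cell-by-cell operator of element integrals. $\mathcal{P}_{CG,\ell-1}^{\ell}\colon\mathbb{V}_{CG,\ell-1}\to\mathbb{V}_{CG,\ell}$ is the natural embedding $v\mapsto v|_{\Omega_\ell}$ (in coefficients), and $\mathcal{R}_{CG,\ell}^{\ell-1}=(\mathcal{P}_{CG,\ell-1}^{\ell})^T$. With $P_0,P_1$ the 1D matrices that interpolate a degree-$p$ polynomial on $[0,1]$ from its Gauss–Lobatto nodal values to the nodal values on $[0,\frac12]$ and $[\frac12,1]$, the cell-wise prolongation $\mathcal{P}_{\mathrm{cell},\ell-1}^{\ell}\colon\mathbb{V}_{\mathrm{cell},\ell-1}\to\mathbb{V}_{\mathrm{cell},\ell}$ is $(\mathcal{P}_{\mathrm{cell},\ell-1}^{\ell}u)|_{K_c}=\bigl(\bigotimes_{i=1}^dP_{b_i}\bigr)u|_K$ for every child $K_c$ of every refined $K\in\mathcal{T}_{\ell-1}$. The cell-wise restriction is $\mathcal{R}_{\mathrm{cell},\ell}^{\ell-1}=(\mathcal{P}_{\mathrm{cell},\ell-1}^{\ell})^T$, i.e. $(\mathcal{R}_{\mathrm{cell},\ell}^{\ell-1}r)|_K=\sum_{c}\bigl(\bigotimes_iP_{b_i}^T\bigr)r|_{K_c}$ (zero on cells $K$ without children). *)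

(* Defs.v *)
From mathcomp Require Import all_boot all_order all_algebra perm.
From mathcomp Require Import all_classical all_reals all_analysis.

Set Implicit Arguments.
Unset Strict Implicit.
Unset Printing Implicit Defensive.

Import Order.TTheory GRing.Theory Num.Theory.
Import numFieldNormedType.Exports.
Local Open Scope classical_set_scope.
Local Open Scope ring_scope.

Definition topological_boundary (X : topologicalType) (A : set X) : set X :=
  closure A `\` interior A.

(* Rodrigues formula for the Legendre polynomial shifted to [0, 1], i.e.
   P_p(2 X - 1). *)
Definition shifted_legendre (R : realType) (p : nat) : {poly R} :=
  (p`!%:R)^-1 *: (('X^2 - 'X) ^+ p)^`(p).

Definition gauss_lobatto (R : realType) (p : nat) (x : 'I_p.+1 -> R) : Prop :=
  [/\ x ord0 = 0, x ord_max = 1,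
      forall i j : 'I_p.+1, (i < j)%N -> x i < x j
    & forall i : 'I_p.+1, (0 < i < p)%N ->
        root (shifted_legendre R p)^`() (x i)].

Definition lagrange_poly (R : realType) (p : nat) (x : 'I_p.+1 -> R)
    (j : 'I_p.+1) : {poly R} :=
  \prod_(k < p.+1 | k != j) ((x j - x k)^-1 *: ('X - (x k)%:P)).

(* P_0 = interp1 x false and P_1 = interp1 x true: the i-th node of the half
   interval number b is (x_i + b) / 2. *)
Definition interp1 (R : realType) (p : nat) (x : 'I_p.+1 -> R) (b : bool)
    : 'M[R]_p.+1 :=
  \matrix_(i, j) (lagrange_poly x j).[(x i + b%:R) / 2].

Definition ref_cube (R : realType) (d : nat) : set 'rV[R]_d :=
  [set xi | forall i, 0 <= xi 0 i <= 1].

(* Some b in position i fixes the i-th coordinate to b, None leaves it free. *)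
Definition face (d : nat) := {ffun 'I_d -> option bool}.

Definition proper_face (d : nat) (f : face d) : Prop := exists i, f i != None.

Definition ref_face (R : realType) (d : nat) (f : face d) : set 'rV[R]_d :=
  [set xi | ref_cube xi /\ forall i b, f i = Some b -> xi 0 i = b%:R].

(* The symmetries of the reference cell: permutation of the axes by s composed
   with the reflections flagged by e. *)
Definition cube_sym (R : realType) (d : nat) (s : 'S_d)
    (e : {ffun 'I_d -> bool}) (xi : 'rV[R]_d) : 'rV[R]_d :=
  \row_i (if e i then 1 - xi 0 (s i) else xi 0 (s i)).

(* A child index c is given by its bits b_1, ..., b_d. *)
Definition child (d : nat) := {ffun 'I_d -> bool}.

Definition child_ref (R : realType) (d : nat) (c : child d) (xi : 'rV[R]_d)
    : 'rV[R]_d :=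
  \row_i ((xi 0 i + (c i)%:R) / 2).

(* A domain Omega with a conforming coarse mesh and an arbitrary local
   refinement pattern.  [ref_map K] is the reference map F_K; conformity means
   that two distinct cells are disjoint or meet exactly in a common face, on
   which their parametrisations agree up to a symmetry of the reference cell.
   The boundary of Omega is resolved by the mesh, i.e. it is a union of closed
   coarse faces; this is automatic when Omega is the interior of the union of
   the cells.  The reference maps are arbitrary embeddings of the cube, d-linear
   or curved.
   A refined cell is addressed by its coarse ancestor and the list of child
   indices leading to it, the LAST refinement step coming FIRST in the list;
   [refined K s] is only meaningful when the cell (K, s) exists. *)
Record mesh (R : realType) (d : nat) (Omega : set 'rV[R]_d) := Mesh {
  coarse : finType ;
  ref_map : coarse -> 'rV[R]_d -> 'rV[R]_d ;
  refined : coarse -> seq (child d) -> bool ;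
  mesh_open : open Omega ;
  mesh_cover : closure Omega = \bigcup_K (ref_map K @` @ref_cube R d) ;
  ref_map_continuous : forall K, {within @ref_cube R d, continuous (ref_map K)} ;
  ref_map_inj : forall K, {in @ref_cube R d &, injective (ref_map K)} ;
  mesh_conforming : forall K K', K != K' ->
    let I := (ref_map K @` @ref_cube R d) `&` (ref_map K' @` @ref_cube R d) in
    I = set0 \/
    exists (f : face d) (s : 'S_d) (e : {ffun 'I_d -> bool}),
      [/\ proper_face f, I = ref_map K @` @ref_face R d f
        & forall xi, ref_face f xi ->
            ref_map K' (cube_sym s e xi) = ref_map K xi] ;
  mesh_boundary : exists B : set (coarse * face d),
    (forall Kf, B Kf -> proper_face Kf.2) /\
    topological_boundary Omega =
      \bigcup_(Kf in B) (ref_map Kf.1 @` @ref_face R d Kf.2)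
}.

Section Levels.
Variables (R : realType) (d : nat) (Omega : set 'rV[R]_d) (T : mesh Omega).
Implicit Types l : nat.

Fixpoint present (K : coarse T) (s : seq (child d)) : bool :=
  if s is c :: s' then refined K s' && present K s' else true.

(* The set T_l of all cells of level l, further refined or not. *)
Definition cell l :=
  {K : coarse T * l.-tuple (child d) | present K.1 K.2}.

Fixpoint path_map (K : coarse T) (s : seq (child d)) (xi : 'rV[R]_d)
    : 'rV[R]_d :=
  if s is c :: s' then path_map K s' (child_ref c xi) else ref_map K xi.

Definition cell_map l (K : cell l) : 'rV[R]_d -> 'rV[R]_d :=
  path_map (val K).1 (val K).2.

Definition level_domain l : set 'rV[R]_d :=
  \bigcup_(K : cell l) (cell_map K @` @ref_cube R d).

(* K' is the child number c of K. *)
Definition is_child l (K' : cell l.+1) (K : cell l) (c : child d) : bool :=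
  ((val K').1 == (val K).1) &&
  ((val K').2 == c :: (val K).2 :> seq (child d)).

End Levels.

Section FiniteElements.
Variables (R : realType) (d : nat) (Omega : set 'rV[R]_d) (T : mesh Omega).
Variables (p : nat) (x : 'I_p.+1 -> R).
Implicit Types l : nat.

Definition midx := {ffun 'I_d -> 'I_p.+1}.

Definition is_Qp (q : 'rV[R]_d -> R) : Prop :=
  exists a : midx -> R, forall xi, ref_cube xi ->
    q xi = \sum_(al : midx) a al * \prod_i xi 0 i ^+ al i.

(* V_CG,l as a space of functions; only the values on Omega_l matter. *)
Definition V_CG l : set ('rV[R]_d -> R) :=
  [set v | [/\ {within level_domain T l, continuous v},
               forall K : cell T l, is_Qp (v \o cell_map K)
             & forall z, level_domain T l z -> topological_boundary Omega z ->
                 v z = 0]].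

Definition node l (K : cell T l) (al : midx) : 'rV[R]_d :=
  cell_map K (\row_i x (al i)).

(* The global degrees of freedom of level l are the nodes off the boundary of
   Omega, each point being listed once however many cells share it. *)
Definition dofs l : seq 'rV[R]_d :=
  undup [seq z <- [seq node Ka.1 Ka.2 | Ka : cell T l * midx]
        | z \notin topological_boundary Omega].

Notation ndof l := (size (dofs l)).

Definition dof l (j : 'I_(ndof l)) : 'rV[R]_d := tnth (in_tuple (dofs l)) j.

Definition coefs l (v : 'rV[R]_d -> R) : 'cV[R]_(ndof l) :=
  \col_j v (dof j).

(* The nodal basis function of the j-th degree of freedom: the element of
   V_CG,l, unique on Omega_l, that is 1 at this node and 0 at the others. *)
Definition nodal_basis l (j : 'I_(ndof l)) : 'rV[R]_d -> R :=
  xget (fun=> 0) [set v | V_CG l v /\ coefs l v = delta_mx j 0].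

(* V_CG,l-coefficient vectors are 'cV_(ndof l); V_cell,l is 'cV_(nloc l), whose
   entries are numbered by pairs (cell, local node) through enum_val.  The dual
   spaces are identified with the same column vectors by the Euclidean pairing,
   so that transposition of operators is transposition of matrices. *)
Definition local_dof l : finType := (cell T l * midx)%type.
Definition nloc l := #|local_dof l|.

Definition gather l : 'M[R]_(nloc l, ndof l) :=
  \matrix_(a, j) (let: (K, al) := (enum_val a : local_dof l) in
                  (node K al == dof j)%:R).

(* The natural embedding v |-> v|_(Omega_(l+1)): column j is the coefficient
   vector on level l+1 of the j-th nodal basis function of level l. *)
Definition prol_CG l : 'M[R]_(ndof l.+1, ndof l) :=
  \matrix_(i, j) coefs l.+1 (nodal_basis j) i 0.

Definition rest_CG l : 'M[R]_(ndof l, ndof l.+1) := (prol_CG l)^T.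

(* The block of rows of K' and columns of K is the Kronecker product of the
   P_(b_i) if K' is the child of K with bits b, and 0 if K' is no child of K. *)
Definition prol_cell l : 'M[R]_(nloc l.+1, nloc l) :=
  \matrix_(a, b) (let: (K', be) := (enum_val a : local_dof l.+1) in
                  let: (K, al) := (enum_val b : local_dof l) in
                  \sum_(c : child d | is_child K' K c)
                    \prod_i interp1 x (c i) (be i) (al i)).

Definition rest_cell l : 'M[R]_(nloc l, nloc l.+1) := (prol_cell l)^T.

(* E K is the element matrix of K: E K al be is the element integral of the
   bilinear form on the be-th (trial) and al-th (test) local shape functions. *)
Definition cell_operator l (E : cell T l -> midx -> midx -> R)
    : 'M[R]_(nloc l) :=
  \matrix_(a, b) (let: (K, al) := (enum_val a : local_dof l) in
                  let: (K', be) := (enum_val b : local_dof l) in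
                  if K == K' then E K al be else 0).

End FiniteElements.

Notation ndof T x l := (size (dofs T x l)).

(* Main.v *)
(* Everything reduces to P_cell G_l = G_(l+1) P_CG, because C_HN P_CG = P_CG and
   the identity is its transpose.  Column j says that tensor-product
   interpolation of the local values of the j-th nodal basis function phi_j
   gives the values of phi_j at the nodes of the children.  This holds since
   phi_j is a Q_p function on every cell of level l, provided that phi_j exists
   at all.

   Existence of phi_j needs the conformity of every level: cell-wise
   interpolants of nodal values must agree at common points.  If two cells of
   the same level share a point, then some symmetry of the reference cube
   carries the smallest reference face through this point in one cell to the one
   in the other cell, compatibly with the cell maps; this passes from parents to
   children.  The Gauss-Lobatto nodes are invariant under t |-> 1 - t, so that
   the symmetry also matches nodes and shape functions, and only the shape
   functions of the nodes on the smallest face are nonzero at the point. *)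
Require Import Defs.
From mathcomp Require Import all_boot all_order all_algebra perm.
From mathcomp Require Import all_classical all_reals all_analysis.
From mathcomp Require Import ring lra zify.
Set Implicit Arguments.
Unset Strict Implicit.
Unset Printing Implicit Defensive.
Import Order.TTheory GRing.Theory Num.Theory.
Import numFieldNormedType.Exports.
Local Open Scope classical_set_scope.
Local Open Scope ring_scope.

(** * Reflection symmetry of the Gauss-Lobatto nodes and 1D Lagrange interpolation *)

Lemma derivn_comp_1subX (R : comNzRingType) (g : {poly R}) (n : nat) :
  g \Po (1 - 'X) = g -> g^`(n) \Po (1 - 'X) = (-1) ^+ n *: g^`(n).
Proof.
move=> hg; elim: n => [|n IH]; first by rewrite expr0 scale1r.
have := congr1 (@deriv R) IH.
rewrite deriv_comp derivZ -derivnS derivB derivX -polyC1 derivC sub0r mulrN1.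
by move=> /eqP; rewrite eqr_oppLR => /eqP ->; rewrite exprS mulN1r scaleNr.
Qed.

Section GaussLobatto.
Variables (R : realType) (p : nat) (x : 'I_p.+1 -> R).

Definition legendre_base : {poly R} := ('X^2 - 'X) ^+ p.

Lemma size_legendre_base : size legendre_base = p.*2.+1.
Proof.
have sz : size ('X^2 - 'X : {poly R}) = 3%N.
  by rewrite size_polyDl size_polyXn // size_polyN size_polyX.
have h0 : legendre_base != 0 by rewrite expf_neq0 // -size_poly_eq0 sz.
have := size_exp ('X^2 - 'X : {poly R}) p; rewrite sz /= mul2n => <-.
by rewrite prednK // lt0n size_poly_eq0.
Qed.

Lemma shifted_legendre_deriv :
  (shifted_legendre R p)^`() = (p`!%:R)^-1 *: legendre_base^`(p.+1).
Proof. by rewrite /shifted_legendre derivZ. Qed.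

(** [X^2 - X] is invariant under [X -> 1 - X], so every derivative of its powers is even or odd
    about 1/2. *)
Lemma root_shifted_legendre_sym (z : R) :
  root (shifted_legendre R p)^`() z -> root (shifted_legendre R p)^`() (1 - z).
Proof.
rewrite shifted_legendre_deriv !rootZ ?invr_eq0 ?pnatr_eq0 -?lt0n ?fact_gt0 //.
have hg : legendre_base \Po (1 - 'X) = legendre_base.
  rewrite /legendre_base rmorphXn /= !(rmorphB, rmorphXn) /= !comp_polyX.
  by congr (_ ^+ _); ring.
move=> /rootP hz; apply/rootP.
have -> : 1 - z = (1 - 'X : {poly R}).[z] by rewrite !hornerE.
by rewrite -horner_comp derivn_comp_1subX // hornerZ hz mulr0.
Qed.

Lemma size_shifted_legendre_deriv :
  (size (shifted_legendre R p)^`() <= p)%N.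
Proof.
rewrite shifted_legendre_deriv; apply: leq_trans (size_scale_leq _ _) _.
apply/leq_sizeP => j hj; rewrite coef_derivn nth_default ?mul0rn //.
by rewrite size_legendre_base -addnn; lia.
Qed.

Lemma shifted_legendre_deriv_neq0 :
  (0 < p)%N -> (shifted_legendre R p)^`() != 0.
Proof.
move=> hp; rewrite shifted_legendre_deriv scaler_eq0 negb_or.
rewrite invr_eq0 pnatr_eq0 -lt0n fact_gt0 /=; apply/eqP.
(* The coefficient of index [p - 1] is a positive falling factorial times the leading coefficient of
   [legendre_base], which has degree [2p]. *)
move=> /(congr1 (fun q : {poly R} => q`_p.-1)).
rewrite -derivnS coef_derivn coef0.
have -> : (p.+1 + p.-1 = (size legendre_base).-1)%N.
  by rewrite size_legendre_base -addnn; lia.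
move=> /eqP; rewrite mulrn_eq0 -lead_coefE lead_coef_eq0 -size_poly_eq0.
rewrite {2}size_legendre_base orbF -leqn0 leqNgt ffact_gt0.
rewrite size_legendre_base -addnn.
by case/negP; lia.
Qed.

Hypothesis hx : gauss_lobatto x.

Lemma gauss_lobatto_inj : injective x.
Proof.
case: hx => _ _ mono _ i j hij; apply/val_inj.
by case: (ltngtP i j) => // /mono; rewrite hij ltxx.
Qed.

Lemma gauss_lobatto_itv i : 0 <= x i <= 1.
Proof.
case: hx => x0 x1 mono _; rewrite -x0 -x1; apply/andP; split.
  have [/mono/ltW//|] := ltnP (@ord0 p) i; rewrite leqn0 => /eqP h.
  by rewrite (_ : i = ord0) //; apply/val_inj.
have [/mono/ltW//|h] := ltnP i (@ord_max p).
rewrite (_ : i = ord_max) //; apply: val_inj => /=; apply/eqP.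
by rewrite eqn_leq h andbT -ltnS.
Qed.

(** The polynomial [Q] of the proof has degree at most [p + 1] and vanishes at the [p + 1] nodes and
    at their reflections. So each reflected node is a node, and two strictly increasing enumerations
    of one set coincide. *)
Lemma gauss_lobatto_sym i : (0 < p)%N -> x (rev_ord i) = 1 - x i.
Proof.
move=> hp; have [x0 x1 mono hr] := hx.
pose Q := (shifted_legendre R p)^`() * ('X * ('X - 1%:P)).
have hL := shifted_legendre_deriv_neq0 hp.
have Q0 : Q != 0 by rewrite !mulf_neq0 ?polyX_eq0 ?polyXsubC_eq0.
have szQ : (size Q <= p.+2)%N.
  rewrite size_mul ?mulf_neq0 ?polyX_eq0 ?polyXsubC_eq0 //.
  rewrite size_mul ?polyX_eq0 ?polyXsubC_eq0 // size_polyX size_XsubC.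
  by rewrite addn3 /= !ltnS size_shifted_legendre_deriv.
have rootQ k : root Q (x k).
  rewrite !rootM root_XsubC rootX.
  have [/hr -> //|] := boolP (0 < k < p)%N.
  rewrite negb_and -!leqNgt leqn0 => /orP[/eqP h|h].
    by rewrite (_ : k = ord0) ?x0 ?eqxx ?orbT //; apply/val_inj.
  rewrite (_ : k = ord_max) ?x1 ?eqxx ?orbT //; apply: val_inj => /=; apply/eqP.
  by rewrite eqn_leq h andbT -ltnS.
have rootQsym z : root Q z -> root Q (1 - z).
  rewrite !rootM !root_XsubC !rootX => /orP[/root_shifted_legendre_sym ->//|].
  by case/orP => /eqP ->; rewrite ?subr0 ?subrr eqxx !orbT.
pose X := [seq x k | k <- enum 'I_p.+1].
pose Y := [seq 1 - x (rev_ord k) | k <- enum 'I_p.+1].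
have srtI : sorted (fun a b : 'I_p.+1 => (a < b)%N) (enum 'I_p.+1).
  by rewrite -(sorted_map (f := val) (e' := ltn)) val_enum_ord iota_ltn_sorted.
have srtX : sorted <%R X.
  by rewrite sorted_map; apply: sub_sorted srtI => a b /=; exact: mono.
have srtY : sorted <%R Y.
  rewrite sorted_map; apply: sub_sorted srtI => a b /= hab.
  rewrite ltrD2l ltrN2; apply: mono => /=.
  by have := ltn_ord a; have := ltn_ord b; lia.
have uX := lt_sorted_uniq srtX; have uY := lt_sorted_uniq srtY.
have sYX : {subset Y <= X}.
  move=> y hy; apply: contraT => hyX.
  have hu : uniq (y :: X) by rewrite /= hyX.
  have ha : all (root Q) (y :: X).
    apply/allP => z; rewrite inE => /orP[/eqP->|/mapP[k _ ->]//].
    by move: hy => /mapP[k _ ->]; exact: rootQsym.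
  have := leq_trans (max_poly_roots Q0 ha hu) szQ.
  by rewrite /= size_map size_enum_ord ltnn.
have [_ eXY] := uniq_min_size uY sYX ltac:(by rewrite !size_map).
have := lt_sorted_eq srtY srtX eXY => /eq_in_map/(_ i) h.
by rewrite -(h (mem_enum _ i)); ring.
Qed.

Lemma lagrange_node i j : (lagrange_poly x j).[x i] = (i == j)%:R.
Proof.
rewrite /lagrange_poly horner_prod; have [->|ne] := eqVneq i j.
  apply: big1 => k hk; rewrite !hornerE mulVf // subr_eq0.
  by apply: contra_neq hk => /gauss_lobatto_inj ->.
by rewrite (bigD1 i) //= !hornerE subrr mulr0 mul0r.
Qed.

Lemma size_lagrange_poly j : (size (lagrange_poly x j) <= p.+1)%N.
Proof.
rewrite /lagrange_poly scaler_prod; apply: leq_trans (size_scale_leq _ _) _.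
rewrite -big_filter size_prod_XsubC size_filter -sum1_count sum1_card.
by rewrite (cardC1 j) card_ord.
Qed.

(** The difference has degree at most [p] and vanishes at the [p + 1] distinct nodes. *)
Lemma lagrange_interpolation (q : {poly R}) :
  (size q <= p.+1)%N -> q = \sum_j q.[x j] *: lagrange_poly x j.
Proof.
move=> sq; apply/eqP; rewrite -subr_eq0; apply: contraT => h0.
have uX : uniq [seq x k | k <- enum 'I_p.+1].
  by rewrite (map_inj_uniq gauss_lobatto_inj) enum_uniq.
set r := (X in X != 0) in h0.
have hr : all (root r) [seq x k | k <- enum 'I_p.+1].
  apply/allP => _ /mapP[k _ ->]; apply/rootP.
  rewrite /r hornerD hornerN horner_sum (bigD1 k) //= big1 ?addr0.
    by rewrite hornerZ lagrange_node eqxx mulr1 subrr.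
  by move=> j jk; rewrite hornerZ lagrange_node eq_sym (negPf jk) mulr0.
have := max_poly_roots h0 hr uX; rewrite size_map size_enum_ord ltnNge.
apply: contraNT => _; apply: leq_trans (size_polyD _ _) _.
rewrite geq_max sq size_polyN /=; apply: (leq_trans (size_sum _ _ _)).
apply/bigmax_leqP => j _; apply: leq_trans (size_scale_leq _ _) _.
exact: size_lagrange_poly.
Qed.

Lemma lagrange_sym i t : (0 < p)%N ->
  (lagrange_poly x (rev_ord i)).[1 - t] = (lagrange_poly x i).[t].
Proof.
move=> hp; rewrite /lagrange_poly !horner_prod.
rewrite (reindex_inj rev_ord_inj) /=; apply: eq_big => k.
  by rewrite (inj_eq rev_ord_inj).
move=> _; rewrite !hornerE !gauss_lobatto_sym //.
have -> : 1 - x i - (1 - x k) = - (x i - x k) by ring.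
have -> : 1 - t - (1 - x k) = - (t - x k) by ring.
by rewrite invrN mulrNN.
Qed.

End GaussLobatto.

(** * Faces and symmetries of the reference cube under subdivision *)

Section ReferenceCube.
Variables (R : realType) (d : nat).
Implicit Types (xi eta : 'rV[R]_d) (c : child d).

(** For [xi] in the cube, this is the smallest closed face through [xi]: coordinates strictly
    between 0 and 1 stay free. *)
Definition min_face xi : set 'rV[R]_d :=
  [set eta | ref_cube eta /\
     forall i (b : bool), xi 0 i = b%:R -> eta 0 i = b%:R].

Lemma min_face_sub (f : face d) xi :
  ref_face f xi -> min_face xi `<=` ref_face f.
Proof. by move=> [_ hf] eta [ceta he]; split=> // i b /hf /he. Qed.

Lemma child_ref_cube c xi : ref_cube xi -> ref_cube (child_ref c xi).
Proof. by move=> h i; rewrite mxE; have := h i; case: (c i) => /=; lra. Qed.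

(** For [t] in [0, 1], [(t + b) / 2] is 0 or 1 only if [t] and [b] are both that end, so a
    coordinate fixed by the image point is already fixed by [xi]. *)
Lemma min_face_child c xi eta :
  ref_cube xi -> min_face xi eta -> min_face (child_ref c xi) (child_ref c eta).
Proof.
move=> hxi [heta he]; split; first exact: child_ref_cube.
move=> i b; rewrite !mxE; move: (hxi i) (he i b).
by case: (c i); case: b => /= h1 h2 h3; try lra; rewrite h2 //; lra.
Qed.

Lemma cube_sym_cube (s : 'S_d) e xi : ref_cube xi -> ref_cube (cube_sym s e xi).
Proof. by move=> h i; rewrite mxE; have := h (s i); case: (e i) => /=; lra. Qed.

Lemma min_face_sym (s : 'S_d) e xi eta :
  min_face xi eta -> min_face (cube_sym s e xi) (cube_sym s e eta).
Proof.
move=> [ceta h]; split=> [|i b]; first exact: cube_sym_cube.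
rewrite !mxE; case: (e i); last exact: h.
by move: (h (s i) (~~ b)); case: b => /= h1 h2; rewrite h1; lra.
Qed.

(* In a direction in which two children differ they only share the common
   midpoint hyperplane, which the two children see from opposite sides. *)
Lemma child_ref_sym (c1 c2 : child d) (s : 'S_d) (e : {ffun 'I_d -> bool})
    xi1 xi2 :
  ref_cube xi1 -> ref_cube xi2 ->
  cube_sym s e (child_ref c1 xi1) = child_ref c2 xi2 ->
  exists e', cube_sym s e' xi1 = xi2 /\
    forall eta, min_face xi1 eta ->
      cube_sym s e (child_ref c1 eta) = child_ref c2 (cube_sym s e' eta).
Proof.
(* If [e] carries the half [c1 (s i)] to the half [c2 i], this flag is [e i]; otherwise the point
   lies on the midpoint hyperplane and the flag is the negation of [e i]. *)
move=> h1 h2 E; exists [ffun i => c1 (s i) != c2 i].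
have Ei i : (if e i then 1 - (xi1 0 (s i) + (c1 (s i))%:R) / 2
     else (xi1 0 (s i) + (c1 (s i))%:R) / 2) = (xi2 0 i + (c2 i)%:R) / 2.
  by move/rowP: E => /(_ i); rewrite !mxE.
split=> [|eta [ceta he]]; apply/rowP => i; rewrite !mxE ffunE.
  move: (Ei i) (h1 (s i)) (h2 i).
  by case: (e i); case: (c1 (s i)); case: (c2 i) => /=; lra.
have he0 := he (s i) false; have he1 := he (s i) true.
move: (Ei i) (h1 (s i)) (h2 i) he0 he1 => /=.
case: (e i); case: (c1 (s i)); case: (c2 i) => /= A1 A2 A3 A4 A5; try lra.
all: first [by rewrite A4; lra | by rewrite A5; lra].
Qed.

End ReferenceCube.

(** * Conformity of every level, boundary faces and compactness of cells *)

Section Conformity.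
Variables (R : realType) (d : nat) (Omega : set 'rV[R]_d) (T : mesh Omega).
Implicit Types (K : coarse T) (s : seq (child d)) (xi eta : 'rV[R]_d).

(** Pointwise form of [mesh_conforming]: the common face contains the smallest face through the
    point. For [K1 = K2] the identity symmetry works. *)
Lemma ref_map_conforming K1 K2 xi1 xi2 :
  ref_cube xi1 -> ref_cube xi2 -> ref_map K1 xi1 = ref_map K2 xi2 ->
  exists (s : 'S_d) (e : {ffun 'I_d -> bool}), cube_sym s e xi1 = xi2 /\
    forall eta, min_face xi1 eta ->
      ref_map K2 (cube_sym s e eta) = ref_map K1 eta.
Proof.
move=> h1 h2 E; have [eK|neK] := eqVneq K1 K2.
  subst K2; exists 1%g, [ffun=> false].
  have Eid eta : cube_sym 1%g [ffun=> false] eta = eta.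
    by apply/rowP => i; rewrite mxE ffunE perm1.
  rewrite Eid; split=> [|eta _]; last by rewrite Eid.
  by apply: (@ref_map_inj _ _ _ T K1) => //; rewrite inE.
have mI : (ref_map K1 @` @ref_cube R d `&` ref_map K2 @` @ref_cube R d)
    (ref_map K1 xi1).
  by split; [exists xi1 | exists xi2].
case: (mesh_conforming neK) => [I0|[f [s [e [_ If hse]]]]].
  by rewrite I0 in mI.
(* [If] only gives some point of the face with this image; injectivity identifies it with [xi1]. *)
have hf : ref_face f xi1.
  move: mI; rewrite If => -[xi hxi Exi].
  rewrite (_ : xi1 = xi) //.
  apply: (@ref_map_inj _ _ _ T K1); rewrite ?inE //; exact: hxi.1.
exists s, e; split=> [|eta /(min_face_sub hf)]; last exact: hse.
apply: (@ref_map_inj _ _ _ T K2); rewrite ?inE //; first exact: cube_sym_cube.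
by rewrite hse.
Qed.

(** Induction on the refinement depth: [child_ref_sym] turns a symmetry between parents into one
    between children. Equal sizes of [s1] and [s2] mean equal levels. *)
Lemma path_map_conforming K1 K2 s1 s2 xi1 xi2 :
  size s1 = size s2 -> ref_cube xi1 -> ref_cube xi2 ->
  Defs.path_map K1 s1 xi1 = Defs.path_map K2 s2 xi2 ->
  exists (s : 'S_d) (e : {ffun 'I_d -> bool}), cube_sym s e xi1 = xi2 /\
    forall eta, min_face xi1 eta ->
      Defs.path_map K2 s2 (cube_sym s e eta) = Defs.path_map K1 s1 eta.
Proof.
elim: s1 s2 xi1 xi2 => [|c1 s1 IH] [|c2 s2] //= xi1 xi2.
  by move=> _; exact: ref_map_conforming.
move=> [hs] h1 h2 /(IH _ _ _ hs (child_ref_cube _ h1) (child_ref_cube _ h2)).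
move=> [s [e [E hse]]]; have [e' [E' he']] := child_ref_sym h1 h2 E.
exists s, e'; split=> // eta heta.
by rewrite -he' // hse //; exact: min_face_child.
Qed.

(** A union of closed faces contains, with each point, the smallest face through it. This is what
    gives interpolants zero boundary values. *)
Lemma boundary_min_face K s xi eta :
  ref_cube xi -> min_face xi eta ->
  topological_boundary Omega (Defs.path_map K s xi) ->
  topological_boundary Omega (Defs.path_map K s eta).
Proof.
elim: s xi eta => [|c s IH] xi eta hxi heta /=; last first.
  by apply: IH; [exact: child_ref_cube | exact: min_face_child].
have [B [_ ->]] := mesh_boundary T => -[Kf BKf [xi' hf E]].
(* The boundary face may belong to another coarse cell than [K]; the symmetry between the two cells
   carries [eta] over. *)
have [s [e [Es hse]]] := ref_map_conforming hxi hf.1 (esym E).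
exists Kf => //; exists (cube_sym s e eta); last exact: hse.
by apply: (min_face_sub hf); rewrite -Es; exact: min_face_sym.
Qed.

Lemma child_ref_continuous (c : child d) : continuous (@child_ref R d c).
Proof.
have -> : @child_ref R d c = fun xi => 2^-1 *: (xi + \row_i (c i)%:R).
  by apply/funext => xi; apply/rowP => i; rewrite !mxE mulrC.
move=> xi; have h : (id : 'rV[R]_d -> 'rV[R]_d) @ xi --> xi by exact: cvg_id.
exact: (cvgZl_tmp (cvgD h (cvg_cst _))).
Qed.

(** Arbitrary compact [C] keeps the induction going: a refinement step replaces [C] by its image in
    the reference cube of the parent. *)
Lemma path_map_compact K s (C : set 'rV[R]_d) :
  C `<=` @ref_cube R d -> compact C -> compact (Defs.path_map K s @` C).
Proof.
elim: s C => [|c s IH] C sC cC /=.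
  apply: continuous_compact cC.
  apply: continuous_subspaceW sC _; exact: ref_map_continuous.
rewrite -(image_comp (child_ref c) (Defs.path_map K s)); apply: IH.
  by move=> _ [xi /sC hxi <-]; exact: child_ref_cube.
apply: continuous_compact cC; apply: continuous_subspaceT.
exact: child_ref_continuous.
Qed.

Lemma ref_cube_compact : compact (@ref_cube R d).
Proof.
have -> : @ref_cube R d =
    [set v : 'rV[R]_d | forall i, `[0 : R, 1]%classic (v ord0 i)].
  by apply/seteqP; split=> v h i; have := h i; rewrite /= in_itv.
apply: (rV_compact (A := fun=> `[0 : R, 1]%classic)) => i.
exact: segment_compact.
Qed.

End Conformity.

(** * Tensor-product shape functions on the reference cube *)

Section Shape.
Variables (R : realType) (d p : nat) (x : 'I_p.+1 -> R).
Implicit Types (al be : midx d p) (xi : 'rV[R]_d).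

Definition ref_node al : 'rV[R]_d := \row_i x (al i).

Definition shape al xi : R := \prod_i (lagrange_poly x (al i)).[xi 0 i].

Lemma shape_continuous al : continuous (shape al).
Proof.
apply: continuous_big => [|i _]; first exact: mul_continuous.
move=> xi; apply: (@continuous_comp _ _ _ (fun v : 'rV[R]_d => v 0 i)).
  exact: coord_continuous.
exact: continuous_horner.
Qed.

Lemma is_Qp_shape_sum (w : midx d p -> R) :
  is_Qp p (fun xi => \sum_al w al * shape al xi).
Proof.
pose a al (be : midx d p) := \prod_i (lagrange_poly x (al i))`_(be i).
exists (fun be => \sum_al w al * a al be) => xi _.
have Ea al : shape al xi = \sum_be a al be * \prod_i xi 0 i ^+ be i.
  (* Padding each factor to [p + 1] coefficients lets the product of sums expand over all
     multi-indices. *)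
  rewrite /shape (eq_bigr _ (fun i _ =>
    horner_coef_wide _ (size_lagrange_poly x (al i)))).
  rewrite bigA_distr_bigA; apply: eq_bigr => be _.
  by rewrite -big_split.
under eq_bigr do rewrite Ea big_distrr /=.
rewrite exchange_big /=; apply: eq_bigr => be _.
by rewrite big_distrl /=; apply: eq_bigr => al _; rewrite mulrA.
Qed.

(** The action of [cube_sym s e] on node indices: [rev_ord] realises [t -> 1 - t] on symmetric
    nodes. *)
Definition midx_sym (s : 'S_d) (e : {ffun 'I_d -> bool}) al : midx d p :=
  [ffun i => if e i then rev_ord (al (s i)) else al (s i)].

Lemma midx_sym_inj s e : injective (midx_sym s e).
Proof.
move=> al be /ffunP h; apply/ffunP => i; have := h (s^-1%g i).
by rewrite !ffunE permKV; case: (e _) => // /rev_ord_inj.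
Qed.

Hypothesis (hp : (0 < p)%N) (hx : gauss_lobatto x).

Lemma ref_node_cube al : ref_cube (ref_node al).
Proof. by move=> i; rewrite mxE; exact: gauss_lobatto_itv. Qed.

Lemma ref_node_sym s e al :
  ref_node (midx_sym s e al) = cube_sym s e (ref_node al).
Proof.
by apply/rowP => i; rewrite !mxE ffunE; case: (e i); rewrite ?gauss_lobatto_sym.
Qed.

Lemma shape_node al be : shape al (ref_node be) = (al == be)%:R.
Proof.
have [->|ne] := eqVneq al be.
  by apply: big1 => i _; rewrite mxE lagrange_node // eqxx.
have [i hi] : exists i, al i != be i.
  apply/existsP; apply: contraNT ne => /existsPn h.
  by apply/eqP; apply/ffunP => i; apply/eqP; exact: negbNE (h i).
by rewrite /shape (bigD1 i) //= mxE lagrange_node // eq_sym (negPf hi) mul0r.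
Qed.

Lemma shape_sym s e al xi :
  shape (midx_sym s e al) (cube_sym s e xi) = shape al xi.
Proof.
rewrite /shape [RHS](reindex_inj (@perm_inj _ s)); apply: eq_bigr => i _.
by rewrite mxE ffunE; case: (e i); rewrite ?lagrange_sym.
Qed.

(** A coordinate 0 or 1 of [xi] is an end node, where only the Lagrange polynomial of that node is
    nonzero. *)
Lemma shape_min_face al xi : shape al xi != 0 -> min_face xi (ref_node al).
Proof.
move=> /prodf_neq0 h; split=> [|i b Ei]; first exact: ref_node_cube.
have [x0 x1 _ _] := hx; have := h i isT; rewrite Ei mxE.
have -> : b%:R = x (if b then ord_max else ord0) by case: (b).
by rewrite lagrange_node // pnatr_eq0 eqb0 negbK => /eqP ->.
Qed.

(** By linearity a monomial suffices, and each of its 1D powers has degree at most [p], so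
    [lagrange_interpolation] reproduces it. *)
Lemma Qp_interpolation (q : 'rV[R]_d -> R) xi : is_Qp p q -> ref_cube xi ->
  q xi = \sum_al q (ref_node al) * shape al xi.
Proof.
move=> [a ha] hxi; rewrite ha //.
transitivity (\sum_be a be * \sum_al
    (\prod_i ref_node al 0 i ^+ be i) * shape al xi).
  apply: eq_bigr => be _; congr (_ * _).
  have E i : xi 0 i ^+ be i =
      \sum_j x j ^+ be i * (lagrange_poly x j).[xi 0 i].
    have sz : (size ('X^(be i) : {poly R}) <= p.+1)%N by rewrite size_polyXn.
    have := congr1 (horner^~ (xi 0 i)) (lagrange_interpolation hx sz).
    rewrite hornerXn horner_sum => ->; apply: eq_bigr => j _.
    by rewrite hornerZ hornerXn.
  rewrite (eq_bigr _ (fun i _ => E i)) bigA_distr_bigA; apply: eq_bigr => al _.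
  by rewrite big_split /=; congr (_ * _); apply: eq_bigr => i _; rewrite mxE.
under eq_bigr do rewrite big_distrr /=.
rewrite exchange_big /=; apply: eq_bigr => al _.
rewrite ha; last exact: ref_node_cube.
by rewrite big_distrl /=; apply: eq_bigr => be _; rewrite mulrA.
Qed.

End Shape.

(** * Global nodal interpolation and existence of the nodal basis *)

Section NodalInterpolation.
Variables (R : realType) (d : nat) (Omega : set 'rV[R]_d) (T : mesh Omega).
Variables (p : nat) (x : 'I_p.+1 -> R).
Hypothesis (hp : (0 < p)%N) (hx : gauss_lobatto x).
Variable (l : nat).
Implicit Types (K : cell T l) (al be : midx d p) (xi : 'rV[R]_d).

Definition cell_interp (w : 'rV[R]_d -> R) K xi : R :=
  \sum_al w (node x K al) * shape x al xi.

(** Glues the cell interpolants without choosing a cell for each point: [cell_interp_agree] makes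
    the value unique on the level domain, and elsewhere it is the default 0. *)
Definition interp (w : 'rV[R]_d -> R) (z : 'rV[R]_d) : R :=
  xget 0 [set y | exists K xi,
    [/\ ref_cube xi, cell_map K xi = z & y = cell_interp w K xi]].

Lemma nodeE K al : node x K al = cell_map K (ref_node x al).
Proof. by []. Qed.

(** After reindexing by the symmetry the shape functions agree, and those nonzero at the point have
    their nodes on its smallest face, where the two cell maps match. *)
Lemma cell_interp_agree w K1 K2 xi1 xi2 :
  ref_cube xi1 -> ref_cube xi2 -> cell_map K1 xi1 = cell_map K2 xi2 ->
  cell_interp w K1 xi1 = cell_interp w K2 xi2.
Proof.
move=> h1 h2 /path_map_conforming.
case=> //; first by rewrite !size_tuple.
move=> s [e [<- hse]]; rewrite /cell_interp.
rewrite [RHS](reindex_inj (@midx_sym_inj _ _ s e)); apply: eq_bigr => al _.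
rewrite shape_sym //; have [->|nz] := eqVneq (shape x al xi1) 0.
  by rewrite !mulr0.
congr (w _ * _); rewrite !nodeE.
by rewrite ref_node_sym // /cell_map hse //; exact: shape_min_face.
Qed.

Lemma interp_cell w K xi :
  ref_cube xi -> interp w (cell_map K xi) = cell_interp w K xi.
Proof.
move=> hxi; apply: xget_subset1; first by exists K, xi.
move=> y1 y2 [K1 [xi1 [h1 E1 ->]]] [K2 [xi2 [h2 E2 ->]]].
by apply: cell_interp_agree => //; rewrite E1.
Qed.

Lemma interp_node w K al : interp w (node x K al) = w (node x K al).
Proof.
rewrite interp_cell; last exact: ref_node_cube.
rewrite /cell_interp (bigD1 al) //= big1 => [|be ne].
  by rewrite shape_node // eqxx mulr1 addr0.
by rewrite shape_node // (negPf ne) mulr0.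
Qed.

Lemma cell_interp_continuous w K : continuous (cell_interp w K).
Proof.
apply: continuous_big => [|al _]; first exact: add_continuous.
by move=> xi; exact: (cvgM (cvg_cst _) (@shape_continuous _ _ _ x al xi)).
Qed.

Lemma closed_cell_image K (C : set 'rV[R]_d) :
  closed C -> closed (cell_map K @` (@ref_cube R d `&` C)).
Proof.
move=> cC; apply: compact_closed; first exact: norm_hausdorff.
apply: path_map_compact; first exact: subIsetl.
by apply: compact_closedI => //; exact: ref_cube_compact.
Qed.

Lemma level_domain_closed : closed (level_domain T l).
Proof.
apply: closed_bigcup => [|K _]; first exact: finite_finset.
rewrite -(setIT (@ref_cube R d)); apply: closed_cell_image; exact: closedT.
Qed.

(* Preimages of closed sets are finite unions of images of compact sets, so
   continuity of the inverse reference maps is not needed. *)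
Lemma interp_continuous w : {within level_domain T l, continuous (interp w)}.
Proof.
apply/continuous_closedP => C cC.
rewrite -closed_setIS; last exact: level_domain_closed.
rewrite (_ : _ `&` _ = \bigcup_(K : cell T l)
    (cell_map K @` (@ref_cube R d `&` cell_interp w K @^-1` C))).
  apply: closed_bigcup => [|K _]; first exact: finite_finset.
  apply: closed_cell_image; move: C cC.
  by apply/continuous_closedP; exact: cell_interp_continuous.
apply/seteqP; split=> z /=.
  move=> [Cz [K _ [xi hxi Ez]]]; exists K => //; exists xi => //.
  by split=> //=; rewrite -interp_cell // Ez.
move=> [K _ [xi [hxi Cxi] <-]]; split; last by exists K => //; exists xi.
by change (C (interp w (cell_map K xi))); rewrite interp_cell.
Qed.

Lemma interp_V_CG w : (forall z, topological_boundary Omega z -> w z = 0) ->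
  V_CG T p l (interp w).
Proof.
move=> w0; split; first exact: interp_continuous.
  move=> K; have [a ha] := is_Qp_shape_sum x (fun al => w (node x K al)).
  by exists a => xi hxi; rewrite /= interp_cell // -ha.
move=> z [K _ [xi hxi <-]] bz; rewrite interp_cell //; apply: big1 => al _.
(* A shape function nonzero at a boundary point has its node on the smallest face through it, hence
   on the boundary, where [w] vanishes. *)
have [->|nz] := eqVneq (shape x al xi) 0; first by rewrite mulr0.
rewrite w0 ?mul0r //; apply: boundary_min_face bz => //.
exact: shape_min_face.
Qed.

Lemma dof_boundary (j : 'I_(ndof T x l)) :
  ~ topological_boundary Omega (dof j).
Proof.
have := mem_tnth j (in_tuple (dofs T x l)).
by rewrite mem_undup mem_filter => /andP[/negP h _]; rewrite inE in h.
Qed.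

Lemma dof_node (j : 'I_(ndof T x l)) : exists K al, dof j = node x K al.
Proof.
have := mem_tnth j (in_tuple (dofs T x l)).
rewrite mem_undup mem_filter => /andP[_ /mapP[[K al] _ E]].
by exists K, al.
Qed.

Lemma dof_inj : injective (@dof R d Omega T p x l).
Proof.
move=> i j; rewrite /dof !(tnth_nth 0) /= => /eqP.
by rewrite nth_uniq ?undup_uniq // => /eqP/val_inj.
Qed.

Lemma node_dof K al : ~ topological_boundary Omega (node x K al) ->
  exists j : 'I_(ndof T x l), dof j = node x K al.
Proof.
move=> nb; have h : node x K al \in dofs T x l.
  rewrite mem_undup mem_filter; apply/andP; split.
    by apply/negP; rewrite inE.
  by apply/mapP; exists (K, al); rewrite ?mem_enum.
have /tnthP[j ->] : node x K al \in in_tuple (dofs T x l) by [].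
by exists j.
Qed.

(** Excludes the default value of [xget] in [nodal_basis]. The witness interpolates the indicator of
    [dof j], which is zero on the boundary since degrees of freedom lie off it. *)
Lemma nodal_basisP (j : 'I_(ndof T x l)) :
  V_CG T p l (nodal_basis j) /\ coefs T x l (nodal_basis j) = delta_mx j 0.
Proof.
apply: (@xgetPex _ _ [set v | V_CG T p l v /\ coefs T x l v = delta_mx j 0]).
exists (interp (fun z => (z == dof j)%:R)); split.
  apply: interp_V_CG => z bz; case: eqP => // E.
  by have := @dof_boundary j; rewrite -E.
apply/matrixP => i k; rewrite !mxE ord1 andbT.
have [K [al Ei]] := dof_node i.
by rewrite Ei interp_node -Ei (inj_eq dof_inj).
Qed.

Lemma V_CG_interpolation v K xi : V_CG T p l v -> ref_cube xi ->
  v (cell_map K xi) = cell_interp v K xi.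
Proof. by move=> [_ /(_ K) hK _] hxi; exact: (Qp_interpolation hx hK). Qed.

(** A boundary node has a zero row in [gather], matching the zero of [v] there; any other node is
    exactly one degree of freedom, so its row selects one coefficient. *)
Lemma gather_coefs (v : 'rV[R]_d -> R) (a : 'I_(nloc T p l)) :
  (forall K al, topological_boundary Omega (node x K al) ->
     v (node x K al) = 0) ->
  (gather T x l *m coefs T x l v) a 0 =
    v (node x (enum_val a : local_dof T p l).1
              (enum_val a : local_dof T p l).2).
Proof.
move=> v0; rewrite mxE.
under eq_bigr do rewrite !mxE.
case: (enum_val a) => K al /=.
have [b|nb] := pselect (topological_boundary Omega (node x K al)).
  rewrite v0 //; apply: big1 => j _; case: eqP => [E|]; last by rewrite mul0r.
  by have := @dof_boundary j; rewrite -E.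
have [j Ej] := node_dof nb; rewrite (bigD1 j) //= -Ej eqxx mul1r big1 ?addr0 //.
by move=> i ne; rewrite (inj_eq dof_inj) eq_sym (negPf ne) mul0r.
Qed.

Lemma gather_nodal_basis (a : 'I_(nloc T p l)) (j : 'I_(ndof T x l)) :
  gather T x l a j = nodal_basis j (node x (enum_val a : local_dof T p l).1
                                           (enum_val a : local_dof T p l).2).
Proof.
have [[_ _ v0] vj] := nodal_basisP j.
rewrite -gather_coefs => [|K al]; last first.
  apply: v0; exists K => //; exists (ref_node x al) => //.
  exact: ref_node_cube.
by rewrite vj -colE [RHS]mxE.
Qed.

End NodalInterpolation.

(** * Commutation of prolongation with gathering *)

Section Prolongation.
Variables (R : realType) (d : nat) (Omega : set 'rV[R]_d) (T : mesh Omega).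
Variables (p : nat) (x : 'I_p.+1 -> R) (l : nat).
Implicit Types (K : cell T l) (Kf : cell T l.+1).

(** The head of an address is the child index and its tail the parent. Their uniqueness collapses
    the sums in [prol_cell_gather]. *)
Lemma parent_cell Kf : exists K c,
  forall K1 c1, is_child Kf K1 c1 = (K1 == K) && (c1 == c).
Proof.
case: Kf => -[K0 t]; case/tupleP: t => c t h.
have hK : present K0 t by move: h => /= /andP[].
exists (exist (fun Kt : coarse T * l.-tuple (child d) => present Kt.1 Kt.2)
  (K0, t) hK), c.
move=> [[K1 t1] h1] c1; rewrite /is_child -val_eqE /= xpair_eqE eqseq_cons.
by rewrite -val_eqE /= eq_sym andbAC -andbA [c == _]eq_sym [tval t == _]eq_sym.
Qed.

Lemma is_child_map Kf K c xi :
  is_child Kf K c -> cell_map Kf xi = cell_map K (child_ref c xi).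
Proof.
by rewrite /is_child /cell_map => /andP[/eqP -> /eqP ->].
Qed.

Hypothesis (hp : (0 < p)%N) (hx : gauss_lobatto x).

Lemma prol_cell_gather :
  prol_cell T x l *m gather T x l = gather T x l.+1 *m prol_CG T x l.
Proof.
apply/matrixP => a j; have [Vj _] := nodal_basisP hp hx j.
have -> : (gather T x l.+1 *m prol_CG T x l) a j =
    (gather T x l.+1 *m coefs T x l.+1 (nodal_basis j)) a 0.
  by rewrite !mxE; apply: eq_bigr => i _; rewrite !mxE.
rewrite gather_coefs; last first.
  (* Zero boundary values of [nodal_basis j] are granted only on the coarser level domain, so the
     fine node is first located in the parent cell. *)
  move=> Kf al; apply: (let: And3 _ _ v0 := Vj in v0).
  have [K [c hc]] := parent_cell Kf; exists K => //.
  exists (child_ref c (ref_node x al)).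
    by apply: child_ref_cube; exact: ref_node_cube.
  by rewrite nodeE (is_child_map _ (K := K) (c := c)) // hc !eqxx.
rewrite mxE; under eq_bigr do rewrite mxE gather_nodal_basis //.
case: (enum_val a) => Kf be /=; have [K [c hc]] := parent_cell Kf.
have hcK : is_child Kf K c by rewrite hc !eqxx.
(* Interpolating in the parent at the image of the fine node under [child_ref c], the shape function
   values are the products of [interp1] entries. *)
rewrite nodeE (is_child_map _ hcK) (V_CG_interpolation hx _ Vj); last first.
  by apply: child_ref_cube; exact: ref_node_cube.
rewrite (reindex _ (onW_bij _ (@enum_rank_bij (local_dof T p l)))) /=.
under eq_bigr do rewrite enum_rankK.
pose G K1 (al : midx d p) := (\sum_(c1 | is_child Kf K1 c1)
  \prod_i interp1 x (c1 i) (be i) (al i)) * nodal_basis j (node x K1 al).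
transitivity (\sum_(K1 : cell T l) \sum_(al : midx d p) G K1 al).
  by rewrite pair_bigA; apply: eq_bigr => -[].
rewrite (bigD1 K) //= [X in _ + X]big1 ?addr0 => [|K1 ne]; last first.
  apply: big1 => al _; rewrite /G big_pred0 ?mul0r // => c1.
  by rewrite hc (negPf ne).
apply: eq_bigr => al _; rewrite /G mulrC; congr (_ * _).
rewrite (big_pred1 c) => [|c1]; last by rewrite hc eqxx.
by apply: eq_bigr => i _; rewrite !mxE.
Qed.

End Prolongation.

Theorem lemma4 (R : realType) (d : nat) (hd : d = 2%N \/ d = 3%N)
    (Omega : set 'rV[R]_d) (T : mesh Omega)
    (p : nat) (hp : (0 < p)%N) (x : 'I_p.+1 -> R) (hx : gauss_lobatto x)
    (l : nat) (C_HN : 'M[R]_(ndof T x l.+1))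
    (hC : forall v : 'cV[R]_(ndof T x l),
        C_HN *m (prol_CG T x l *m v) = prol_CG T x l *m v) :
  (gather T x l)^T *m rest_cell T x l
    = rest_CG T x l *m C_HN^T *m (gather T x l.+1)^T
  /\
  forall (E : cell T l.+1 -> midx d p -> midx d p -> R)
         (b u : 'cV[R]_(nloc T p l.+1)),
    let r := b - cell_operator E *m u in
    (gather T x l)^T *m (rest_cell T x l *m r)
      = rest_CG T x l *m (C_HN^T *m ((gather T x l.+1)^T *m r)).

Proof.
(* Unit vectors turn [hC] into a matrix identity. *)
have CP : C_HN *m prol_CG T x l = prol_CG T x l.
  apply/matrixP => i j; have /matrixP/(_ i 0) := hC (delta_mx j 0).
  by rewrite mulmxA -!colE mxE [RHS]mxE.
have main : (gather T x l)^T *m rest_cell T x l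
    = rest_CG T x l *m C_HN^T *m (gather T x l.+1)^T.
  (* Each side is the transpose of a product of a prolongation and a gather; under the transpose,
     [C_HN] stands directly before [prol_CG]. *)
  by rewrite -!trmx_mul CP prol_cell_gather.
by split=> // E b u r; rewrite !mulmxA main.
Qed.
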